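(* Let $\mathcal{V}\subseteq\mathbb{C}^N$ be a set of complex nodal voltages. If $\mathcal{V}$ is non-singular (i.e. the load-flow Jacobian $\mathbf{J}_{\mathbf{F}}(\mathbf{v})$ is non-singular for every $\mathbf{v}\in\mathcal{V}$) and convex, then $\mathcal{V}$ is a domain of uniqueness, i.e. for all $\mathbf{v},\mathbf{v}'\in\mathcal{V}$, $\mathbf{F}(\mathbf{v})=\mathbf{F}(\mathbf{v}')$ implies $\mathbf{v}=\mathbf{v}'$.
   Context: Grid model. A single-phase grid has one slack bus (index $0$) with fixed complex voltage $v_0\in\mathbb{C}$ and $N$ $PQ$ buses (indices $1,\dots,N$). The $(N+1)\times(N+1)$ complex nodal admittance matrix is partitioned as $\mathbf{Y}=\begin{bmatrix}\mathbf{Y}_{00}&\mathbf{Y}_{0L}\\ \mathbf{Y}_{L0}&\mathbf{Y}_{LL}\end{bmatrix}$, where the $N\times N$ matrix $\mathbf{Y}_{LL}$ is invertible. Put $\mathbf{w}=-\mathbf{Y}_{LL}^{-1}\mathbf{Y}_{L0}v_0\in\mathbb{C}^N$. The load-flow function $\mathbf{F}:\mathbb{C}^N\to\mathbb{C}^N$, which maps a vector of complex nodal voltages $\mathbf{v}=(v_1,\dots,v_N)^T$ to the vector of complex nodal power injections $\mathbf{s}=(s_1,\dots,s_N)^T$, is $$\mathbf{F}(\mathbf{v})=\mathrm{diag}(\mathbf{v})\,\overline{\mathbf{Y}}_{LL}(\overline{\mathbf{v}}-\overline{\mathbf{w}}),$$ where the bar denotes (entrywise) complex conjugation. $\mathbf{J}_{\mathbf{F}}(\mathbf{v})$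 denotes the Jacobian of $\mathbf{F}$ at $\mathbf{v}$, where $\mathbf{F}$ is viewed in rectangular coordinates as a continuously differentiable map $\mathbb{R}^{2N}\to\mathbb{R}^{2N}$ of $(\mathrm{Re}(\mathbf{v}),\mathrm{Im}(\mathbf{v}))$. *)

(* Defs.v *)
From HB Require Import structures.
From mathcomp Require Import all_boot all_order all_algebra.
From mathcomp Require Import boolp classical_sets functions reals topology.
From mathcomp Require Import normedtype derive convex.
From mathcomp Require Import complex.

Set Implicit Arguments.
Unset Strict Implicit.
Unset Printing Implicit Defensive.

Import Order.TTheory GRing.Theory Num.Theory.
Import numFieldNormedType.Exports.

Local Open Scope classical_set_scope.
Local Open Scope ring_scope.

Section LoadFlow.
Context {R : realType} {N : nat}.

(* Bus 0 (slack) is the first row/column of Y; the last N are the PQ buses. *)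
Definition Y_LL (Y : 'M[R[i]]_(1 + N)) : 'M[R[i]]_N := drsubmx Y.
Definition Y_L0 (Y : 'M[R[i]]_(1 + N)) : 'cV[R[i]]_N := dlsubmx Y.

Definition conj_mx m n (A : 'M[R[i]]_(m, n)) : 'M[R[i]]_(m, n) :=
  map_mx (@conjc R) A.

Definition zero_load_voltage (Y : 'M[R[i]]_(1 + N)) (v0 : R[i])
  : 'cV[R[i]]_N := - (v0 *: (invmx (Y_LL Y) *m Y_L0 Y)).

Definition load_flow (Y : 'M[R[i]]_(1 + N)) (v0 : R[i]) (v : 'cV[R[i]]_N)
  : 'cV[R[i]]_N :=
  diag_mx v^T *m conj_mx (Y_LL Y)
    *m (conj_mx v - conj_mx (zero_load_voltage Y v0)).

(* Rectangular coordinates (Re v, Im v), as a row vector because the library's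
   Jacobian is defined for functions between row vectors. *)
Definition to_rect (v : 'cV[R[i]]_N) : 'rV[R]_(N + N) :=
  row_mx (map_mx (@complex.Re R) v)^T (map_mx (@complex.Im R) v)^T.

Definition of_rect (x : 'rV[R]_(N + N)) : 'cV[R[i]]_N :=
  \col_k Complex (lsubmx x 0 k) (rsubmx x 0 k).

Definition load_flow_rect (Y : 'M[R[i]]_(1 + N)) (v0 : R[i])
  : 'rV[R]_(N + N) -> 'rV[R]_(N + N) :=
  to_rect \o load_flow Y v0 \o of_rect.

(* ['J f p] acts on row vectors from the right; its transpose has the partial
   derivative of the i-th component along the j-th coordinate at (i, j). *)
Definition load_flow_jacobian (Y : 'M[R[i]]_(1 + N)) (v0 : R[i])
    (v : 'cV[R[i]]_N) : 'M[R]_(N + N) :=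
  ('J (load_flow_rect Y v0) (to_rect v))^T.

Definition non_singular (Y : 'M[R[i]]_(1 + N)) (v0 : R[i])
    (V : set 'cV[R[i]]_N) : Prop :=
  forall v, V v -> load_flow_jacobian Y v0 v \in unitmx.

(* In the order of R[i], 0 <= t <= 1 forces t to be real, so the library's
   convexity over R[i] is the usual convexity with real weights in [0, 1]. *)
Definition convex (V : set 'cV[R[i]]_N) : Prop :=
  @convex_set R[i] 'cV[R[i]]_N V.

Definition domain_of_uniqueness (Y : 'M[R[i]]_(1 + N)) (v0 : R[i])
    (V : set 'cV[R[i]]_N) : Prop :=
  forall v v' : 'cV[R[i]]_N, V v -> V v' ->
    load_flow Y v0 v = load_flow Y v0 v' -> v = v'.

End LoadFlow.

(* Main.v *)
Require Import Defs.
From HB Require Import structures.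
From mathcomp Require Import all_boot all_order all_algebra.
From mathcomp Require Import boolp classical_sets reals complex.
From mathcomp Require Import topology normedtype derive convex.
From mathcomp Require Import interval_inference.
Import Order.TTheory GRing.Theory Num.Theory.
Import numFieldNormedType.Exports.
Local Open Scope ring_scope.

(** The load flow is quadratic in rectangular coordinates: it has the form
    [x |-> B x (x - c)] with [B] bilinear over the reals. For such an [f] the
    secant from [y] to [x] is given exactly by the derivative at the midpoint,
    [f x - f y = Df((x + y) / 2) (x - y)]. By convexity the midpoint of two
    points of [V] lies in [V], where the Jacobian is invertible, so
    [f x = f y] forces [x = y]. *)

(** Expanding both arguments in the standard basis leaves a finite sum of products of coordinates,
    each scaling a fixed vector. Differentiating [B] requires this continuity. *)
Lemma bilinear_rV_continuous (R : realType) (m n p : nat)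
    (B : {bilinear 'rV[R]_m -> 'rV[R]_n -> 'rV[R]_p}) :
  continuous (fun q : 'rV[R]_m * 'rV[R]_n => B q.1 q.2).
Proof.
have -> : (fun q : 'rV[R]_m * 'rV[R]_n => B q.1 q.2) = fun q =>
    \sum_i \sum_j (q.1 0 i * q.2 0 j) *: B (delta_mx 0 i) (delta_mx 0 j).
  apply/funext => -[x y] /=.
  rewrite {1}(row_sum_delta x) linear_sumlz; apply: eq_bigr => i _.
  rewrite linearZl_LR {1}(row_sum_delta y) linear_sumr scaler_sumr.
  by apply: eq_bigr => j _; rewrite linearZr_LR scalerA.
apply: continuous_big => [|i _]; first exact: add_continuous.
apply: continuous_big => [|j _ q]; first exact: add_continuous.
apply: cvgZr_tmp; apply: cvgM.
- exact: (cvg_comp fst (fun M : 'rV_m => M 0 i) cvg_fst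
    (@coord_continuous R 1 m 0 i q.1)).
- exact: (cvg_comp snd (fun M : 'rV_n => M 0 j) cvg_snd
    (@coord_continuous R 1 n 0 j q.2)).
Qed.

(** Chain rule through the affine map [g], followed by the product rule for [B]. *)
Lemma jacobian_bilinear (R : realType) (n p : nat)
    (B : {bilinear 'rV[R]_n -> 'rV[R]_n -> 'rV[R]_p}) (c m h : 'rV[R]_n) :
  h *m jacobian (fun z => B z (z - c)) m = B m h + B h (m - c).
Proof.
pose g (z : 'rV[R]_n) := (z, z - c).
(* The [0] is the differential of the constant [c]. *)
have dg : is_diff m g (fun h => (h, h - 0)) by apply: is_diff_eq.
have Bc := bilinear_rV_continuous _ _ _ _ B.
have dB := differentiable_bilin (g m) Bc.
rewrite -[fun z => _]/((fun q : 'rV[R]_n * 'rV[R]_n => B q.1 q.2) \o g).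
rewrite /jacobian mul_rV_lin1 diff_comp // /=.
by rewrite diff_bilin // diff_val /= subr0.
Qed.

(* Kept over abstract modules: on concrete row vectors the bilinear rewrite rules
   fail to unify the competing module structures. *)
Lemma bilinear_midpoint (R : numFieldType) (U W : lmodType R)
    (B : {bilinear U -> U -> W}) (c x y : U) :
  let m := 2^-1 *: (x + y) in
  B m (x - y) + B (x - y) (m - c) = B x (x - c) - B y (y - c).
Proof.
move=> m; rewrite (linearBr _ _ m c) addrA.
(* The cross terms [B x y] and [B y x] cancel between the two summands, so no symmetry of [B] is
   required; what remains is doubled, which the factor 1/2 in [m] undoes. *)
have -> : B m (x - y) + B (x - y) m = B x x - B y y.
  rewrite linearZl_LR linearZr_LR -scalerDr.
  rewrite linearBr linearDr !linearBl !linearDl opprD addrACA.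
  rewrite (addrACA (B x x)) subrr addr0 (addrACA (- B x y)) addNr add0r.
  rewrite -!mulr2n -mulrnDl -[(_ - _) *+ 2]scaler_nat scalerA.
  by rewrite mulVf ?pnatr_eq0 // scale1r.
by rewrite linearBl !linearBr !opprD addrACA.
Qed.

Lemma jacobian_midpoint (R : realType) (n p : nat)
    (B : {bilinear 'rV[R]_n -> 'rV[R]_n -> 'rV[R]_p}) (c x y : 'rV[R]_n) :
  (x - y) *m jacobian (fun z => B z (z - c)) (2^-1 *: (x + y)) =
  B x (x - c) - B y (y - c).
Proof. rewrite jacobian_bilinear; exact: bilinear_midpoint. Qed.

Lemma convex_set_midpoint (R : numFieldType) (M : lmodType R) (A : set M)
    (x y : M) : convex_set A -> A x -> A y -> A (2^-1 *: (x + y)).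
Proof.
move=> cA Ax Ay.
(* The weight 1/2 as an element of the unit interval; the order of [R] may be partial, so its being
   real is part of the claim. *)
have h01 : Itv.spec (@Itv.num_sem R) (Itv.Real `[0, 1]%Z) (2^-1 : R).
  rewrite /= /Itv.num_sem /= in_itv /= mulr0z mulr1z invr_ge0 ler0n.
  by rewrite invf_le1 ?ltr0n // ler1n realE invr_ge0 ler0n.
have := cA x y (Itv.mk h01) (mem_set Ax) (mem_set Ay) => /set_mem.
by rewrite /conv /= /unstable.onem {2}(splitr 1) div1r addrK -scalerDr.
Qed.

Section LoadFlowRect.
Variables (R : realType) (N : nat).
Local Notation C := R[i].

Lemma of_rectK : cancel (@of_rect R N) to_rect.
Proof.
move=> x; rewrite -[RHS]hsubmxK; congr row_mx; apply/rowP => k;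
by rewrite !mxE.
Qed.

Lemma to_rectK : cancel (@to_rect R N) of_rect.
Proof.
move=> v; apply/colP => k; rewrite mxE row_mxKl row_mxKr !mxE.
by case: (v k 0).
Qed.

Lemma of_rectP (a : R) x y :
  of_rect (a *: x + y) = real_complex R a *: of_rect x + of_rect y :> 'cV[C]_N.
Proof.
apply/colP => k; rewrite !mxE; apply/eqP; rewrite eq_complex /=.
by rewrite !mul0r subr0 addr0 !eqxx.
Qed.

Lemma to_rectP (a : R) (u v : 'cV[C]_N) :
  to_rect (real_complex R a *: u + v) = a *: to_rect u + to_rect v.
Proof. by apply: (can_inj of_rectK); rewrite of_rectP !to_rectK. Qed.

(** Conjugation is only semilinear over [C], but it fixes real scalars. *)
Lemma conj_mxP (a : R) (u v : 'cV[C]_N) :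
  conj_mx (real_complex R a *: u + v) =
  real_complex R a *: conj_mx u + conj_mx v.
Proof.
by rewrite /conj_mx map_mxD map_mxZ; congr (_ *: _ + _); exact: conjc_real.
Qed.

(** Decouples the plain and the conjugated occurrence of the voltage, which makes the load flow
    bilinear over the reals. *)
Definition flow_form (A : 'M[C]_N) (x y : 'rV[R]_(N + N)) : 'rV[R]_(N + N) :=
  to_rect (diag_mx (of_rect x)^T *m conj_mx A *m conj_mx (of_rect y)).

Lemma flow_form_bilinear (A : 'M[C]_N) :
  bilinear_for (GRing.Scale.Law.clone _ _ *:%R _)
    (GRing.Scale.Law.clone _ _ *:%R _) (flow_form A).
Proof.
split=> [y|x] a u v; rewrite /flow_form of_rectP.
  by rewrite linearP /= linearP /= !mulmxDl -!scalemxAl to_rectP.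
by rewrite conj_mxP mulmxDr -scalemxAr to_rectP.
Qed.

HB.instance Definition _ (A : 'M[C]_N) :=
  bilinear_isBilinear.Build R 'rV[R]_(N + N) 'rV[R]_(N + N) 'rV[R]_(N + N)
    _ _ (flow_form A) (flow_form_bilinear A).

Lemma load_flow_rectE (Y : 'M[C]_(1 + N)) v0 :
  load_flow_rect Y v0 = fun x =>
    flow_form (Y_LL Y) x (x - to_rect (zero_load_voltage Y v0)).
Proof.
apply/funext => x; rewrite /load_flow_rect /flow_form /load_flow /=.
congr (to_rect (_ *m _)).
have -> : of_rect (x - to_rect (zero_load_voltage Y v0)) =
    of_rect x - zero_load_voltage Y v0 :> 'cV[C]_N.
  rewrite -[x - _]addrC -scaleN1r of_rectP to_rectK.
  by rewrite rmorphN1 scaleN1r addrC.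
by rewrite [RHS]map_mxB.
Qed.

(** Convexity yields a midpoint with a complex scalar 1/2, the secant identity one with a real 1/2;
    this reconciles them. *)
Lemma to_rect_midpoint (u v : 'cV[C]_N) :
  to_rect (2^-1 *: (u + v)) = 2^-1 *: (to_rect u + to_rect v).
Proof.
have := to_rectP 1 u v; rewrite rmorph1 !scale1r => <-.
have -> : 2^-1 = real_complex R 2^-1 by rewrite fmorphV rmorph_nat.
have := to_rectP 2^-1 (u + v) 0; rewrite addr0 => ->.
rewrite -[RHS]addr0; congr (_ + _); apply/rowP => k; rewrite !mxE.
by case: splitP => ?; rewrite !mxE.
Qed.

End LoadFlowRect.

Theorem theorem2 (R : realType) (N : nat) (Y : 'M[R[i]]_(1 + N)) (v0 : R[i])
    (Y_LL_inv : Y_LL Y \in unitmx) (V : set 'cV[R[i]]_N) :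
  non_singular Y v0 V -> convex V -> domain_of_uniqueness Y v0 V.
Proof.
move=> nsV cV v v' Vv Vv' Fvv'.
have := nsV _ (convex_set_midpoint _ _ V v v' cV Vv Vv').
(* Dropping the transpose gives the matrix acting on row vectors, as in the secant identity. *)
rewrite /load_flow_jacobian unitmx_tr to_rect_midpoint load_flow_rectE => unitJ.
have flowE u : flow_form R N (Y_LL Y) (to_rect u)
    (to_rect u - to_rect (zero_load_voltage Y v0)) = to_rect (load_flow Y v0 u).
  have := congr1 (@^~ (to_rect u)) (load_flow_rectE R N Y v0).
  by rewrite /load_flow_rect /= to_rectK.
have := jacobian_midpoint _ _ _ (flow_form R N (Y_LL Y))
  (to_rect (zero_load_voltage Y v0)) (to_rect v) (to_rect v').
rewrite /= !flowE Fvv' subrr => secant0.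
apply: (can_inj (to_rectK R N)); apply: subr0_eq.
(* The difference is multiplied by the Jacobian, which gives 0, and then by its inverse. *)
by rewrite -[LHS](mulmxK unitJ) secant0 mul0mx.
Qed.
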